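(* Let $d,n_1,\dots,n_d$ be positive integers, $\Omega\subseteq\mathcal{G}=[n_1]\times\dots\times[n_d]$, and let $\hat T\in\mathbb{R}^\Omega$ have all entries nonzero, such that the exact rank-one completion problem for $(\Omega,\hat T)$ has a unique solution. If SR-propagation is satisfied by $\Omega$, then the optimal solution $\mathbf{X}_c^\epsilon$ of (SDP-N) with noise vector $\epsilon\in\mathbb{R}^\Omega$ and penalty constant $C>0$ obeys $$\|\bar{\mathbf{X}}-\mathbf{X}_c^\epsilon\|_F\le O\Bigl(\chi\bigl(\|\epsilon\|_\infty+\|\epsilon\|_\infty^2C+1/C\bigr)\Bigr),$$ where $\chi(s)=s+\sqrt s$ and $O(\cdot)$ is with respect to $\|\epsilon\|_\infty$ and $C$. In particular, for $C=1/\|\epsilon\|_\infty$ the upper bound is $O\bigl(\sqrt{\|\epsilon\|_\infty}\bigr)$.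
   Context: Notation: $[m]=\{1,\dots,m\}$; $N=n_1\cdots n_d$; $\mathcal{G}=[n_1]\times\dots\times[n_d]$; coordinates of $\mathbb{R}^N$ are indexed by $\mathcal{G}$, $\mathbb{S}^N$ is the space of real symmetric $N\times N$ matrices (rows and columns indexed by $\mathcal{G}$), $\|\cdot\|_F$ is the Frobenius norm. Meaning of $O(\cdot)$: the asymptotic regime is $\|\epsilon\|_\infty\to0$ and $C$ large; i.e. there are constants $K,C_0,\epsilon_0>0$ depending only on $d,n_1,\dots,n_d,\Omega,\hat T$ such that the bound holds with constant $K$ for all $C\ge C_0$, all $\epsilon$ with $\|\epsilon\|_\infty\le\epsilon_0$, and any optimal solution $\mathbf{X}_c^\epsilon$. Exact rank-one completion problem for $(\Omega,\hat T)$: find a rank-one tensor $T\in\mathbb{R}^{n_1\times\dots\times n_d}$ (nonzero, of the form $T_{i_1,\dots,i_d}=\prod_k u^{(k)}_{i_k}$) with $T_\alpha=\hat T_\alpha$ for all $\alpha\in\Omega$. Let $T$ be its unique solution, $\bar x\in\mathbb{R}^N$ the vector with $\bar x_\beta=T_\beta$, and $\bar{\mathbf{X}}=\begin{pmatrix}1 & \bar x^T \\ \bar x & \bar x\bar x^T\end{pmatrix}$. Noisy observations: $T^\epsilon_\alpha=\hat T_\alpha+\epsilon_\alpha$ for $\alpha\in\Omega$. Square: $\{\alpha_1,\alpha_2;\alpha_3,\alpha_4\}$ is a square if $\alpha_1,\dots,\alpha_4\in\mathcal{G}$ are distinct and for every $k\in[d]$, $\max\{(\alpha_1)_k,(\alpha_2)_k\}=\max\{(\alpha_3)_k,(\alpha_4)_k\}$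 and $\min\{(\alpha_1)_k,(\alpha_2)_k\}=\min\{(\alpha_3)_k,(\alpha_4)_k\}$. Let $\mathcal{A}$ be the set of all squares. SR-propagation: let $\mathcal{P}_{SR}(\Omega)$ be the smallest set containing $\Omega$ such that if $\{\alpha_1,\beta;\alpha_2,\gamma\}$ is a square with $\alpha_1,\alpha_2\in\Omega$ and $\beta\in\mathcal{P}_{SR}(\Omega)$, then $\gamma\in\mathcal{P}_{SR}(\Omega)$. $\Omega$ satisfies SR-propagation if $\mathcal{P}_{SR}(\Omega)=\mathcal{G}$. (SDP-N): minimize $\operatorname{tr}(X)+C\sum_{\alpha\in\Omega}\bigl(X_{\alpha,\alpha}-2T^\epsilon_\alpha x_\alpha+(T^\epsilon_\alpha)^2\bigr)$ over $x\in\mathbb{R}^N$, $X\in\mathbb{S}^N$ subject to $X_{\alpha_1,\alpha_2}=X_{\alpha_3,\alpha_4}$ for all $\{\alpha_1,\alpha_2;\alpha_3,\alpha_4\}\in\mathcal{A}$ and $\mathbf{X}:=\begin{pmatrix}1 & x^T \\ x & X\end{pmatrix}\succeq0$. A solution is identified with the matrix $\mathbf{X}$. *)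

(* Defs.v *)
From HB Require Import structures.
From mathcomp Require Import all_boot all_order all_algebra.
From mathcomp Require Import reals.

Set Implicit Arguments.
Unset Strict Implicit.
Unset Printing Implicit Defensive.

Import Order.TTheory GRing.Theory Num.Theory.

Local Open Scope ring_scope.

(* The k-th coordinate ranges over {0, ..., n k - 1} instead of
   {1, ..., n k}; only the order on coordinates matters. *)
Definition grid (d : nat) (n : 'I_d -> nat) := {dffun forall k : 'I_d, 'I_(n k)}.

HB.instance Definition _ d (n : 'I_d -> nat) := Finite.on (grid n).

(* The index set of R^Omega; maps [obs Omega -> R] are its elements. *)
Definition obs d (n : 'I_d -> nat) (Omega : {set grid n}) :=
  {a : grid n | a \in Omega}.

HB.instance Definition _ d (n : 'I_d -> nat) (Omega : {set grid n}) :=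
  Finite.on (obs Omega).

Section Combinatorics.
Context {d : nat} {n : 'I_d -> nat}.
Implicit Types (a b g : grid n) (Omega : {set grid n}).

(* {a1, a2; a3, a4} is a square; the predicate is invariant under exchanging
   a1 and a2, a3 and a4, or the two pairs. *)
Definition square a1 a2 a3 a4 : Prop :=
  uniq [:: a1; a2; a3; a4] /\
  forall k : 'I_d,
    maxn (a1 k) (a2 k) = maxn (a3 k) (a4 k) /\
    minn (a1 k) (a2 k) = minn (a3 k) (a4 k).

Inductive SR_closure Omega : grid n -> Prop :=
| SR_base a : a \in Omega -> SR_closure Omega a
| SR_step a1 a2 b g :
    square a1 b a2 g -> a1 \in Omega -> a2 \in Omega ->
    SR_closure Omega b -> SR_closure Omega g.

Definition SR_propagation Omega : Prop := forall a, SR_closure Omega a.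

End Combinatorics.

Section Completion.
Context {R : realType} {d : nat} {n : 'I_d -> nat}.

Definition rank_one (T : {ffun grid n -> R}) : Prop :=
  T != 0 /\
  exists u : forall k : 'I_d, 'I_(n k) -> R,
    forall a : grid n, T a = \prod_(k < d) u k (a k).

Definition rank_one_completion (Omega : {set grid n}) (That : obs Omega -> R)
    (T : {ffun grid n -> R}) : Prop :=
  rank_one T /\ forall a : obs Omega, T (val a) = That a.

End Completion.

Section Matrices.
Context {R : realType}.

Definition psd m (A : 'M[R]_m) : Prop :=
  A^T = A /\ forall v : 'cV[R]_m, 0 <= (v^T *m A *m v) 0 0.

Definition frobenius m p (A : 'M[R]_(m, p)) : R :=
  Num.sqrt (\sum_i \sum_j A i j ^+ 2).

Definition bordered m (x : 'cV[R]_m) (X : 'M[R]_m) : 'M[R]_(1 + m) :=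
  block_mx 1%:M x^T x X.

Definition sup_norm (I : finType) (e : I -> R) : R :=
  \big[Num.max/0]_(i : I) `|e i|.

Definition chi (s : R) : R := s + Num.sqrt s.

End Matrices.

(* Rows and columns of the N x N matrices, N = #|grid n|, are numbered by
   [enum_rank : grid n -> 'I_#|grid n|]. *)
Section SDP.
Context {R : realType} {d : nat} {n : 'I_d -> nat}.

Definition vec_tensor (T : {ffun grid n -> R}) : 'cV[R]_#|grid n| :=
  \col_i T (enum_val i).

Definition lifted_tensor (T : {ffun grid n -> R}) : 'M[R]_(1 + #|grid n|) :=
  let x := vec_tensor T in bordered x (x *m x^T).

Definition sdp_objective (Omega : {set grid n}) (Te : obs Omega -> R) (C : R)
    (x : 'cV[R]_#|grid n|) (X : 'M[R]_#|grid n|) : R :=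
  \tr X + C * \sum_(a : obs Omega)
    (let r := enum_rank (val a) in
     X r r - 2 * Te a * x r 0 + Te a ^+ 2).

Definition sdp_feasible (x : 'cV[R]_#|grid n|) (X : 'M[R]_#|grid n|) : Prop :=
  [/\ X^T = X,
      forall a1 a2 a3 a4 : grid n, square a1 a2 a3 a4 ->
        X (enum_rank a1) (enum_rank a2) = X (enum_rank a3) (enum_rank a4)
    & psd (bordered x X)].

Definition sdp_optimal (Omega : {set grid n}) (Te : obs Omega -> R) (C : R)
    (x : 'cV[R]_#|grid n|) (X : 'M[R]_#|grid n|) : Prop :=
  sdp_feasible x X /\
  forall y Y, sdp_feasible y Y ->
    sdp_objective Te C x X <= sdp_objective Te C y Y.

End SDP.

(* Main.v *)
Require Import Defs.
From HB Require Import structures.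
From mathcomp Require Import all_boot all_order all_algebra.
From mathcomp Require Import reals.
From mathcomp Require Import ring lra.

Set Implicit Arguments.
Unset Strict Implicit.
Unset Printing Implicit Defensive.

Import Order.TTheory GRing.Theory Num.Theory.

Local Open Scope ring_scope.

(** Write e for the sup norm of the noise, [N] for the number of tensor
entries, [xbar] for the vector of entries of [T], [Q] for its squared norm
and [s = e + e^2 C + 1/C].

The lifted tensor is feasible and costs at most [Q + C |Omega| e^2].  Each
penalty term is a value of the positive semidefinite quadratic form of the
optimal bordered matrix [(x, X)], hence nonnegative.  Comparing costs gives
two facts: [\tr X <= Q + |Omega| e^2 C], and, for each observed entry [a],
the residual [X_aa - 2 T_a x_a + T_a^2] is [O(e^2 + 1/C)].

Suppose [s <= 1]; then all these errors are [O(s)] and [\tr X] is bounded.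
The residual at [a] is the quadratic form at the vector [(-T_a, e_a)], so a
small residual puts this vector almost in the kernel: by Cauchy-Schwarz,
[X_ab = T_a x_b + O(sqrt s)] for every [b], while [x_a = T_a + O(sqrt s)]
([residual_row], [residual_fit]).  If {a1, b; a2, g} is a square with a1 and
a2 observed, the constraint [X_{a1 b} = X_{a2 g}] then reads
[T_a1 x_b = T_a2 x_g + O(sqrt s)], whereas [T_a1 T_b = T_a2 T_g] since [T]
has rank one.  Dividing by [T_a2], the error at g is at most a constant times
the error at b plus [O(sqrt s)], and SR-propagation carries the estimate to
every entry ([SR_error_propagation]).

It remains to control [X] itself, and this is where minimizing the trace
matters: [\tr (X - x x^T) = \tr X - |x|^2 <= Q - |x|^2 + O(s)], which is
[O(sqrt s)] because [x] is close to [xbar] ([trace_gap]).  Since [X - x x^T]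
is positive semidefinite, its trace bounds its entries, so [X] is within
[O(sqrt s)] of [xbar xbar^T].  The small regime is [trace_stability].

If [s > 1], the trace bound alone gives an error [O(s)]
([trace_crude_bound]); the two regimes are the two terms of [chi s].  For
[C = 1/e] one has [s = 3 e]. *)

(** * Squares and absolute values *)

Lemma sqr_le_norm_bound (R : realType) (x a : R) : x ^+ 2 <= a -> `|x| <= 1 + a.
Proof. by move=> xa; rewrite ler_norml; apply/andP; split; nra. Qed.

Lemma sqr_le_norm (R : realType) (x r : R) :
  0 <= r -> x ^+ 2 <= r ^+ 2 -> `|x| <= r.
Proof. by move=> r0; rewrite -real_normK ?num_real // ler_pXn2r ?nnegrE. Qed.

(** * Positive semidefinite bordered matrices *)

(** The form at [u + t v] is a quadratic polynomial in [t] that is nowhere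
negative, so its discriminant is nonpositive. *)
Lemma psd_cauchy_schwarz (R : realType) m (A : 'M[R]_m) (u v : 'cV[R]_m) :
  psd A ->
  ((u^T *m A *m v) 0 0) ^+ 2
    <= (u^T *m A *m u) 0 0 * (v^T *m A *m v) 0 0.
Proof.
move=> [Asym Apos].
set p := (u^T *m A *m u) 0 0; set q := (v^T *m A *m v) 0 0.
set b := (u^T *m A *m v) 0 0.
have quad t : 0 <= p + 2 * t * b + t ^+ 2 * q.
  have := Apos (u + t *: v).
  have vu : v^T *m A *m u = (u^T *m A *m v)^T.
    by rewrite !trmx_mul trmxK Asym mulmxA.
  have -> : (u + t *: v)^T = u^T + t *: v^T by apply/matrixP=> i j; rewrite !mxE.
  rewrite !mulmxDl !mulmxDr -!scalemxAl -!scalemxAr vu.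
  rewrite /p /b /q; move: (u^T *m A *m u) (u^T *m A *m v) (v^T *m A *m v).
  move=> P B Q; rewrite !mxE => h; apply: le_trans h _.
  by rewrite le_eqVlt; apply/orP; left; apply/eqP; ring.
have q0 : 0 <= q := Apos v.
case: (ltrgtP q 0) (q0) => // [qpos|qz] _.
  have := quad (- b / q) => h.
  have : 0 <= (p + 2 * (- b / q) * b + (- b / q) ^+ 2 * q) * q by rewrite mulr_ge0.
  have -> : (p + 2 * (- b / q) * b + (- b / q) ^+ 2 * q) * q = p * q - b ^+ 2.
    by field; rewrite gt_eqF.
  by rewrite subr_ge0.
rewrite qz mulr0; have [->|b0] := eqVneq b 0; first by rewrite expr0n.
(* With [q = 0] the polynomial is affine; at this point it equals -1. *)
have := quad (- (p + 1) / (2 * b)); rewrite qz mulr0 addr0.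
have -> : p + 2 * (- (p + 1) / (2 * b)) * b = -1 by field.
by rewrite oppr_ge0 ler10.
Qed.

(** The form of a bordered matrix at such a vector is the residual at the entry
[i] when [a = - T_i], and a diagonal entry of the Schur complement
[X - x x^T] when [a = - x_i]. *)
Definition border_vec (R : realType) m (a : R) (i : 'I_m) : 'cV[R]_(1 + m) :=
  col_mx a%:M (delta_mx i 0).

Lemma bordered_form (R : realType) m (x : 'cV[R]_m) (X : 'M[R]_m) a b i j :
  ((border_vec a i)^T *m bordered x X *m border_vec b j) 0 0
    = a * b + a * x j 0 + b * x i 0 + X i j.
Proof.
rewrite /border_vec /bordered tr_col_mx tr_scalar_mx mul_row_block mul_row_col.
rewrite trmx_delta mulmx1 !mulmxDl -!rowE -mulmxA -!colE.
rewrite -scalar_mxM mul_scalar_mx mul_mx_scalar !mxE /= !mulr1n.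
ring.
Qed.

Lemma bordered_cauchy_schwarz (R : realType) m (x : 'cV[R]_m) (X : 'M[R]_m)
    a b i j :
  psd (bordered x X) ->
  (a * b + a * x j 0 + b * x i 0 + X i j) ^+ 2
    <= (a ^+ 2 + 2 * a * x i 0 + X i i) * (b ^+ 2 + 2 * b * x j 0 + X j j).
Proof.
move/(psd_cauchy_schwarz (border_vec a i) (border_vec b j)).
rewrite !bordered_form => h; apply: le_trans h _.
by rewrite le_eqVlt; apply/orP; left; apply/eqP; ring.
Qed.

Lemma bordered_diag (R : realType) m (x : 'cV[R]_m) (X : 'M[R]_m) i :
  psd (bordered x X) -> x i 0 ^+ 2 <= X i i.
Proof.
move=> [_ /(_ (border_vec (- x i 0) i))]; rewrite bordered_form => h; nra.
Qed.

(** The Schur complement [X - x x^T] has nonnegative diagonal, so each of its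
diagonal entries is at most its trace. *)
Lemma bordered_diag_tr (R : realType) m (x : 'cV[R]_m) (X : 'M[R]_m) i :
  psd (bordered x X) -> X i i - x i 0 ^+ 2 <= \tr X - \sum_j x j 0 ^+ 2.
Proof.
move=> pX; rewrite /mxtrace -sumrB (bigD1 i) //= lerDl sumr_ge0 // => j _.
by rewrite subr_ge0 bordered_diag.
Qed.

(** The entry (i, j) of the Schur complement is the bordered form at
[(- x_i, e_i)] and [(- x_j, e_j)], so Cauchy-Schwarz bounds it by the diagonal
entries, hence by the trace. *)
Lemma bordered_schur_entry (R : realType) m (x : 'cV[R]_m) (X : 'M[R]_m) i j :
  psd (bordered x X) ->
  `|X i j - x i 0 * x j 0| <= \tr X - \sum_k x k 0 ^+ 2.
Proof.
move=> pX; have hi := bordered_diag_tr i pX; have hj := bordered_diag_tr j pX.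
have di := bordered_diag i pX; have dj := bordered_diag j pX.
have := bordered_cauchy_schwarz (- x i 0) (- x j 0) i j pX.
set D := \tr X - _ in hi hj * => h.
apply: sqr_le_norm; first by lra.
have -> : X i j - x i 0 * x j 0 =
  - x i 0 * - x j 0 + - x i 0 * x j 0 + - x j 0 * x i 0 + X i j by ring.
apply: le_trans h _; rewrite expr2; apply: ler_pM; nra.
Qed.

Lemma bordered_diag_le_tr (R : realType) m (x : 'cV[R]_m) (X : 'M[R]_m) i :
  psd (bordered x X) -> X i i <= \tr X.
Proof.
move=> pX; rewrite /mxtrace (bigD1 i) //= lerDl sumr_ge0 // => j _.
exact: le_trans (sqr_ge0 (x j 0)) (bordered_diag j pX).
Qed.

Lemma bordered_entry_le_tr (R : realType) m (x : 'cV[R]_m) (X : 'M[R]_m) i j :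
  psd (bordered x X) -> `|X i j| <= \tr X.
Proof.
move=> pX; have hi := bordered_diag_le_tr i pX.
have hj := bordered_diag_le_tr j pX.
have di := bordered_diag i pX; have dj := bordered_diag j pX.
have si := sqr_ge0 (x i 0); have sj := sqr_ge0 (x j 0).
have := bordered_cauchy_schwarz 0 0 i j pX.
rewrite !(mul0r, mulr0, expr0n) /= !add0r => h.
apply: sqr_le_norm; first by lra.
by apply: le_trans h _; rewrite expr2; apply: ler_pM => //; lra.
Qed.

(** The matrix is the square [w w^T] of the column [w = (1, y)]. *)
Lemma rank_one_psd (R : realType) m (y : 'cV[R]_m) :
  psd (bordered y (y *m y^T)).
Proof.
have -> : bordered y (y *m y^T) = col_mx 1%:M y *m (col_mx 1%:M y)^T.
  by rewrite tr_col_mx mul_col_row trmx1 !(mul1mx, mulmx1).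
set w := col_mx _ _; split; first by rewrite trmx_mul trmxK.
move=> v; rewrite mulmxA -mulmxA; set c := v^T *m w.
have -> : w^T *m v = c^T by rewrite trmx_mul trmxK.
by rewrite mxE big_ord1 !mxE -expr2 sqr_ge0.
Qed.

(** * Norms *)

Lemma frobenius_entry_bound (R : realType) m p (A : 'M[R]_(m, p)) c :
  0 <= c -> (forall i j, `|A i j| <= c) -> frobenius A <= (m * p)%:R * c.
Proof.
move=> c0 Ac; rewrite /frobenius.
rewrite -[leRHS]ger0_norm ?mulr_ge0 // -sqrtr_sqr; apply: ler_wsqrtr.
have h : \sum_i \sum_j A i j ^+ 2 <= \sum_(i < m) \sum_(j < p) c ^+ 2.
  apply: ler_sum => i _; apply: ler_sum => j _.
  by rewrite -real_normK ?num_real // lerXn2r ?nnegrE.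
apply: le_trans h _.
rewrite !sumr_const !card_ord -mulrnA mulnC exprMn -[leLHS]mulr_natl.
rewrite ler_wpM2r ?sqr_ge0 // -natrX ler_nat.
by case: (m * p)%N => // k; rewrite -mulnn leq_pmulr.
Qed.

Lemma frobenius_bordered_bound (R : realType) m (x y : 'cV[R]_m)
    (X Y : 'M[R]_m) c :
  0 <= c -> (forall i, `|y i 0 - x i 0| <= c) ->
  (forall i j, `|Y i j - X i j| <= c) ->
  frobenius (bordered y Y - bordered x X) <= ((1 + m) * (1 + m))%:R * c.
Proof.
move=> c0 hx hX; apply: frobenius_entry_bound => // i j.
rewrite /bordered opp_block_mx add_block_mx.
case: (split_ordP i) => i' ->; case: (split_ordP j) => j' ->.
- by rewrite block_mxEul !mxE subrr normr0.
- by rewrite block_mxEur ord1 !mxE.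
- by rewrite block_mxEdl (ord1 j') !mxE.
- by rewrite block_mxEdr !mxE.
Qed.

Lemma sup_norm_ge (R : realType) (I : finType) (e : I -> R) i :
  `|e i| <= sup_norm e.
Proof. exact: (le_bigmax 0 (fun i => `|e i|)). Qed.

Lemma sup_norm_ge0 (R : realType) (I : finType) (e : I -> R) : 0 <= sup_norm e.
Proof. exact: bigmax_ge_id. Qed.

(** * Propagation of errors along squares *)

Section Propagation.
Context {R : realType} {d : nat} {n : 'I_d -> nat}.
Variable T : {ffun grid n -> R}.
Hypothesis T1 : rank_one T.

(** In each coordinate the two sides of a square use the same unordered pair of
indices, so the products of the rank-one factors agree coordinatewise. *)
Lemma rank_one_square a1 a2 a3 a4 :
  square a1 a2 a3 a4 -> T a1 * T a2 = T a3 * T a4.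
Proof.
case: T1 => _ [u uE] [_ h].
rewrite !uE -!big_split; apply: eq_bigr => k _ /=.
have [] := h k.
case: (leqP (a1 k) (a2 k)) => _; case: (leqP (a3 k) (a4 k)) => _ mx mn;
  by rewrite (val_inj mx) (val_inj mn) // mulrC.
Qed.

Lemma lifted_feasible :
  sdp_feasible (vec_tensor T) (vec_tensor T *m (vec_tensor T)^T).
Proof.
split; [by rewrite trmx_mul trmxK | | exact: rank_one_psd].
move=> a1 a2 a3 a4 /rank_one_square.
by rewrite !mxE !big_ord1 !mxE !enum_rankK.
Qed.

(** The constant depends on [T] and on the chain of squares leading to [g], but
not on the matrix or on [r]; this is what makes the final estimate uniform
over all noise vectors, penalties and optimal solutions.  A square with
observed [a1], [a2] costs a factor [|T_a1 / T_a2|] and an additive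
[2 r / |T_a2|].  Only the observed entries of [T] are divided by. *)
Lemma SR_error_propagation (Omega : {set grid n}) :
  (forall a, a \in Omega -> T a != 0) ->
  forall g, SR_closure Omega g ->
  exists2 K : R, 0 <= K & forall x X (r : R), sdp_feasible x X -> 0 <= r ->
    (forall a, a \in Omega -> `|x (enum_rank a) 0 - T a| <= r) ->
    (forall a b, a \in Omega ->
       `|X (enum_rank a) (enum_rank b) - T a * x (enum_rank b) 0| <= r) ->
    `|x (enum_rank g) 0 - T g| <= K * r.
Proof.
move=> T0 g; elim=> [a aO|a1 a2 b c sq a1O a2O _ [K K0 IH]].
  by exists 1 => // x X r _ _ /(_ a aO); rewrite mul1r.
exists ((2 + `|T a1| * K) / `|T a2|).
  by rewrite divr_ge0 ?addr_ge0 ?mulr_ge0.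
move=> x X r fX r0 xO XO; have Hb := IH _ _ _ fX r0 xO XO.
have n2 : 0 < `|T a2| by rewrite normr_gt0 T0.
rewrite mulrAC ler_pdivlMr // mulrC -normrM.
case: fX => _ /(_ _ _ _ _ sq) Xsq _.
have Tsq := rank_one_square sq.
have -> : T a2 * (x (enum_rank c) 0 - T c) =
  (X (enum_rank a1) (enum_rank b) - T a1 * x (enum_rank b) 0)
  - (X (enum_rank a2) (enum_rank c) - T a2 * x (enum_rank c) 0)
  + T a1 * (x (enum_rank b) 0 - T b).
  by rewrite Xsq !mulrBr Tsq; ring.
have h1 := XO a1 b a1O; have h2 := XO a2 c a2O.
have h3 : `|T a1 * (x (enum_rank b) 0 - T b)| <= `|T a1| * (K * r).
  by rewrite normrM ler_wpM2l.
apply: le_trans (ler_normD _ _) _.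
apply: le_trans (lerD (ler_normB _ _) (lexx _)) _.
rewrite mulrDl -mulrA; lra.
Qed.

Lemma SR_uniform_propagation (Omega : {set grid n}) :
  (forall a, a \in Omega -> T a != 0) -> SR_propagation Omega ->
  exists2 K : R, 0 <= K & forall x X (r : R), sdp_feasible x X -> 0 <= r ->
    (forall a, a \in Omega -> `|x (enum_rank a) 0 - T a| <= r) ->
    (forall a b, a \in Omega ->
       `|X (enum_rank a) (enum_rank b) - T a * x (enum_rank b) 0| <= r) ->
    forall i, `|vec_tensor T i 0 - x i 0| <= K * r.
Proof.
move=> T0 SR.
have [K K0 HK] := fin_all_exists2 (fun g => SR_error_propagation T0 (SR g)).
exists (\sum_g K g) => [|x X r fX r0 xO XO i]; first exact: sumr_ge0.
have := HK (enum_val i) x X r fX r0 xO XO.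
rewrite enum_valK mxE distrC => h; apply: le_trans h _.
apply: ler_wpM2r => //; rewrite (bigD1 (enum_val i)) //= lerDl.
exact: sumr_ge0.
Qed.

End Propagation.
(** * Stability of trace minimization *)

Section Stability.
Context {R : realType} {d : nat} {n : 'I_d -> nat}.
Variables (T : {ffun grid n -> R}) (Omega : {set grid n}).

Definition energy : R := \sum_i vec_tensor T i 0 ^+ 2.

Lemma energy_ge0 : 0 <= energy.
Proof. by apply: sumr_ge0 => i _; apply: sqr_ge0. Qed.

Lemma vec_tensor_bound i : `|vec_tensor T i 0| <= 1 + energy.
Proof.
apply: sqr_le_norm_bound; rewrite /energy (bigD1 i) //= lerDl sumr_ge0 // => j _.
exact: sqr_ge0.
Qed.

(** The noiseless penalty at [a], i.e. the bordered form at [(- T_a, e_a)]. *)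
Definition residual (x : 'cV[R]_#|grid n|) (X : 'M[R]_#|grid n|) (a : grid n) : R :=
  let r := enum_rank a in X r r - 2 * T a * x r 0 + T a ^+ 2.

Lemma residual_fit x X a : psd (bordered x X) ->
  (x (enum_rank a) 0 - T a) ^+ 2 <= residual x X a.
Proof.
by move=> /(bordered_diag (enum_rank a)); rewrite /residual => h; nra.
Qed.

(** The left-hand side is the square of the bordered form at [(- T_a, e_a)] and
[(0, e_b)]: a vector of small energy is nearly orthogonal to all others. *)
Lemma residual_row x X a b : psd (bordered x X) ->
  (X (enum_rank a) (enum_rank b) - T a * x (enum_rank b) 0) ^+ 2
    <= residual x X a * \tr X.
Proof.
move=> pX.
have := bordered_cauchy_schwarz (- T a) 0 (enum_rank a) (enum_rank b) pX.
have -> : - T a * 0 + - T a * x (enum_rank b) 0 + 0 * x (enum_rank a) 0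
    + X (enum_rank a) (enum_rank b)
  = X (enum_rank a) (enum_rank b) - T a * x (enum_rank b) 0 by ring.
rewrite !(mul0r, mulr0, expr0n) /= !add0r sqrrN => h.
apply: le_trans h _.
have -> : T a ^+ 2 + 2 * - T a * x (enum_rank a) 0
  + X (enum_rank a) (enum_rank a) = residual x X a by rewrite /residual; ring.
apply: ler_wpM2l; last exact: bordered_diag_le_tr pX.
exact: le_trans (sqr_ge0 _) (residual_fit _ pX).
Qed.

(** The trace of [X - x x^T] is nearly [|xbar|^2 - |x|^2], which is first order
in the distance from [x] to [xbar]. *)
Lemma trace_gap (x : 'cV[R]_#|grid n|) (X : 'M[R]_#|grid n|) (c rho : R) : 0 <= rho ->
  (forall i, `|vec_tensor T i 0 - x i 0| <= rho) -> \tr X <= energy + c ->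
  \tr X - \sum_i x i 0 ^+ 2 <= #|grid n|%:R * (2 * (1 + energy) * rho) + c.
Proof.
move=> rho0 xr trX.
suff h : energy - \sum_i x i 0 ^+ 2 <= #|grid n|%:R * (2 * (1 + energy) * rho).
  by lra.
rewrite mulr_natl -[X in _ *+ X]card_ord -sumr_const /energy -sumrB -/energy.
apply: ler_sum => i _; have := vec_tensor_bound i; have := xr i.
set y := vec_tensor T i 0; set z := x i 0 => yz yb.
have -> : y ^+ 2 - z ^+ 2 = 2 * y * (y - z) - (y - z) ^+ 2 by ring.
have : y * (y - z) <= (1 + energy) * rho.
  by apply: le_trans (ler_norm _) _; rewrite normrM; apply: ler_pM.
have := sqr_ge0 (y - z); lra.
Qed.

(** This is the regime of small [s], separated from the semidefinite program:
small residuals determine [x] up to [O(sqrt s)] by propagation, and the near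
minimal trace then determines [X].  The square root comes from the use of
Cauchy-Schwarz in [residual_row]. *)
Lemma trace_stability (m B : R) : rank_one T -> (forall a, a \in Omega -> T a != 0) ->
  SR_propagation Omega -> 0 <= m -> 0 <= B ->
  exists2 K : R, 0 <= K & forall x X (s : R), sdp_feasible x X -> 0 <= s -> s <= 1 ->
    \tr X <= energy + m * s ->
    (forall a, a \in Omega -> residual x X a <= B * s) ->
    (forall i, `|vec_tensor T i 0 - x i 0| <= K * Num.sqrt s) /\
    (forall i j, `|vec_tensor T i 0 * vec_tensor T j 0 - X i j|
                   <= K * Num.sqrt s).
Proof.
move=> T1 T0 SR m0 B0.
have [k k0 prop] := SR_uniform_propagation T1 T0 SR.
have Q0 := energy_ge0; set A := energy + m.
have A0 : 0 <= A by rewrite addr_ge0.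
(* [A] bounds the trace, and [(1 + A + B) * sqrt s] both kinds of errors
   that enter the propagation: [B s] and [A B s] are at most its square. *)
pose k' := k * (1 + A + B).
have k'0 : 0 <= k' by rewrite /k' mulr_ge0 // !addr_ge0.
pose N : R := #|grid n|%:R; have N0 : 0 <= N by [].
(* [k1] accounts for [xbar xbar^T - x x^T], [k2] for [trace_gap]. *)
pose k1 := k' * (2 + energy + A); pose k2 := k' * (N * (2 * (1 + energy))).
have k10 : 0 <= k1 by apply: mulr_ge0 => //; lra.
have k20 : 0 <= k2 by do 2 apply: mulr_ge0 => //; lra.
exists (k' + k1 + k2 + m); first by rewrite !addr_ge0.
move=> x X s fX s0 s1 trX res; have [_ _ pX] := fX.
set q := Num.sqrt s; have q0 : 0 <= q by apply: sqrtr_ge0.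
have qs : q ^+ 2 = s by rewrite sqr_sqrtr.
have sq : s <= q by nra.
have trA : \tr X <= A.
  by apply: le_trans trX _; rewrite lerD2l ler_piMr.
have r0 : 0 <= (1 + A + B) * q by rewrite mulr_ge0 // !addr_ge0.
have xT : forall i, `|vec_tensor T i 0 - x i 0| <= k' * q.
  rewrite /k' -mulrA; apply: (prop _ _ _ fX r0) => [a aO|a b aO].
    apply: sqr_le_norm => //; apply: le_trans (residual_fit _ pX) _.
    apply: le_trans (res _ aO) _; rewrite exprMn qs ler_wpM2r //; nra.
  apply: sqr_le_norm => //; apply: le_trans (residual_row _ _ pX) _.
  have ra0 := le_trans (sqr_ge0 _) (residual_fit a pX).
  have ti0 : 0 <= \tr X.
    exact: le_trans (normr_ge0 _)
      (bordered_entry_le_tr (enum_rank a) (enum_rank a) pX).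
  apply: le_trans (_ : B * s * A <= _); first by apply: ler_pM => //; apply: res.
  by rewrite exprMn qs mulrAC ler_wpM2r //; nra.
have k1q : 0 <= k1 * q by rewrite mulr_ge0.
have k2q : 0 <= k2 * q by rewrite mulr_ge0.
have k'q : 0 <= k' * q by rewrite mulr_ge0.
have mq : 0 <= m * q by rewrite mulr_ge0.
split=> [i|i j]; first by apply: le_trans (xT i) _; rewrite !mulrDl; lra.
have gap := trace_gap k'q xT trX.
have schur := bordered_schur_entry i j pX.
have ms : m * s <= m * q by rewrite ler_wpM2l.
have xj : `|x j 0| <= 1 + A.
  apply: sqr_le_norm_bound; apply: le_trans trA.
  exact: le_trans (bordered_diag j pX) (bordered_diag_le_tr j pX).
have -> : vec_tensor T i 0 * vec_tensor T j 0 - X i j =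
  vec_tensor T i 0 * (vec_tensor T j 0 - x j 0)
  + (vec_tensor T i 0 - x i 0) * x j 0 - (X i j - x i 0 * x j 0) by ring.
apply: le_trans (ler_normB _ _) _.
apply: le_trans (lerD (ler_normD _ _) (lexx _)) _.
have h1 : `|vec_tensor T i 0 * (vec_tensor T j 0 - x j 0)|
    <= (1 + energy) * (k' * q).
  by rewrite normrM; apply: ler_pM => //; apply: vec_tensor_bound.
have h2 : `|(vec_tensor T i 0 - x i 0) * x j 0| <= k' * q * (1 + A).
  by rewrite normrM; apply: ler_pM.
have e1 : (1 + energy) * (k' * q) + k' * q * (1 + A) = k1 * q.
  by rewrite /k1; ring.
have e2 : N * (2 * (1 + energy) * (k' * q)) = k2 * q by rewrite /k2; ring.
rewrite -/N e2 in gap.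
have -> : (k' + k1 + k2 + m) * q = k' * q + k1 * q + k2 * q + m * q by ring.
by clear -h1 h2 e1 gap schur ms k'q; lra.
Qed.

(** For large [s] the trace bound is already linear in [s], and the trace
dominates every entry of a positive semidefinite matrix; propagation would
give the worse power [s^(3/2)]. *)
Lemma trace_crude_bound (x : 'cV[R]_#|grid n|) (X : 'M[R]_#|grid n|) (m s : R) :
  psd (bordered x X) -> 0 <= m -> 1 <= s ->
  \tr X <= energy + m * s ->
  (forall i, `|vec_tensor T i 0 - x i 0| <= ((1 + energy) ^+ 2 + 1 + energy + m) * s) /\
  (forall i j, `|vec_tensor T i 0 * vec_tensor T j 0 - X i j|
                 <= ((1 + energy) ^+ 2 + 1 + energy + m) * s).
Proof.
move=> pX m0 s1 trX; have Q0 := energy_ge0.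
have Es : energy <= energy * s by rewrite ler_peMr.
have E2s : (1 + energy) ^+ 2 <= (1 + energy) ^+ 2 * s by rewrite ler_peMr ?sqr_ge0.
split=> [i|i j].
  have := vec_tensor_bound i => h1.
  have h2 : `|x i 0| <= 1 + \tr X.
    apply: sqr_le_norm_bound.
    exact: le_trans (bordered_diag i pX) (bordered_diag_le_tr i pX).
  apply: le_trans (ler_normB _ _) _; rewrite !mulrDl mul1r.
  have : 1 + energy <= (1 + energy) ^+ 2 by rewrite expr2 ler_peMr ?lerDl ?addr_ge0.
  by clear -h1 h2 trX Es E2s s1; lra.
apply: le_trans (ler_normB _ _) _; rewrite normrM !mulrDl mul1r.
have h1 := bordered_entry_le_tr i j pX.
have h2 : `|vec_tensor T i 0| * `|vec_tensor T j 0| <= (1 + energy) ^+ 2.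
  by rewrite expr2; apply: ler_pM => //; apply: vec_tensor_bound.
by clear -h1 h2 trX Es E2s s1; lra.
Qed.

(** * Comparison of optimal solutions with the lifted tensor *)

Variable That : obs Omega -> R.
Hypothesis fit : forall a : obs Omega, T (val a) = That a.

(** The lifted tensor is a competitor whose penalty at [a] is [eps_a ^+ 2]. *)
Lemma optimal_value_bound (eps : obs Omega -> R) (C : R) x X : 0 <= C ->
  sdp_optimal (fun a => That a + eps a) C x X -> rank_one T ->
  sdp_objective (fun a => That a + eps a) C x X
    <= energy + C * (#|{: obs Omega}|%:R * sup_norm eps ^+ 2).
Proof.
move=> C0 [_ opt] T1; apply: le_trans (opt _ _ (lifted_feasible T1)) _.
rewrite /sdp_objective; apply: lerD.
  rewrite /mxtrace /energy; apply: ler_sum => i _.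
  by rewrite !mxE big_ord1 !mxE -expr2.
apply: ler_wpM2l => //; rewrite mulr_natl -sumr_const; apply: ler_sum => a _ /=.
rewrite !mxE big_ord1 !mxE !enum_rankK fit.
have -> : That a * That a - 2 * (That a + eps a) * That a + (That a + eps a) ^+ 2
  = eps a ^+ 2 by ring.
rewrite -real_normK ?num_real // lerXn2r ?nnegrE ?sup_norm_ge0 //.
exact: sup_norm_ge.
Qed.

Lemma noisy_residual_ge0 (t : R) (x : 'cV[R]_#|grid n|)
    (X : 'M[R]_#|grid n|) i :
  psd (bordered x X) ->
  0 <= X i i - 2 * t * x i 0 + t ^+ 2.
Proof.
by move=> /(bordered_diag i) h; have := sqr_ge0 (x i 0 - t); nra.
Qed.

Lemma optimal_trace_bound (eps : obs Omega -> R) (C : R) x X : 0 <= C ->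
  sdp_optimal (fun a => That a + eps a) C x X -> rank_one T ->
  \tr X <= energy + #|{: obs Omega}|%:R * (sup_norm eps ^+ 2 * C).
Proof.
move=> C0 opt T1; have := optimal_value_bound C0 opt T1.
have [[_ _ pX] _] := opt; rewrite /sdp_objective; set S := \sum_a _.
have : 0 <= C * S.
  apply: mulr_ge0 => //; apply: sumr_ge0 => a _; exact: noisy_residual_ge0.
by rewrite [C * (_ * _)]mulrC -mulrA; lra.
Qed.

(** A single penalty term, all others and the trace being nonnegative, is at
most [energy / C] plus the total noise; replacing the noisy by the exact
observation costs a factor 2 and [2 * eps_a ^+ 2]. *)
Lemma optimal_residual_bound (eps : obs Omega -> R) (C : R) x X a : 0 < C ->
  sdp_optimal (fun a => That a + eps a) C x X -> rank_one T -> a \in Omega ->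
  residual x X a
    <= 2 * (energy * C^-1 + #|{: obs Omega}|%:R * sup_norm eps ^+ 2)
       + 2 * sup_norm eps ^+ 2.
Proof.
move=> C0 opt T1 aO; have := optimal_value_bound (ltW C0) opt T1.
have [[_ _ pX] _] := opt; rewrite /sdp_objective.
pose o : obs Omega := Sub a aO; have vo : val o = a by apply: SubK.
rewrite (bigD1 o) //= -[That o]fit vo; set S := \sum_(i | _) _.
have S0 : 0 <= S by apply: sumr_ge0 => b _; exact: noisy_residual_ge0.
set t := T a + eps o; set r := enum_rank a; set M := _ * sup_norm eps ^+ 2 => value.
have tr0 : 0 <= \tr X.
  by apply: sumr_ge0 => i _; apply: le_trans (sqr_ge0 _) (bordered_diag i pX).
have loss : X r r - 2 * t * x r 0 + t ^+ 2 <= energy * C^-1 + M.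
  rewrite -(ler_pM2l C0); apply: le_trans (_ : energy + C * M <= _).
    by have := mulr_ge0 (ltW C0) S0; rewrite mulrDr in value; lra.
  by rewrite mulrDr [C * (energy * _)]mulrCA mulfV ?gt_eqF // mulr1.
have e2 : eps o ^+ 2 <= sup_norm eps ^+ 2.
  rewrite -real_normK ?num_real // lerXn2r ?nnegrE ?sup_norm_ge0 //.
  exact: sup_norm_ge.
have := bordered_diag r pX; rewrite /residual -/r.
(* Twice the noisy penalty plus [2 * eps_o ^+ 2], minus the residual, is the
   sum of [X r r - x r 0 ^+ 2] and this square. *)
have sq := sqr_ge0 (x r 0 - T a - 2 * eps o).
rewrite /t in loss; clear -loss e2 sq => dr.
nra.
Qed.

(** The two regimes meet at [s = 1].  Below it, [e <= s <= 1] gives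
[e ^+ 2 <= s], so that the residuals are [O(s)] as [trace_stability] asks. *)
Lemma recovery_error_bound : rank_one T ->
  (forall a, a \in Omega -> T a != 0) -> SR_propagation Omega ->
  exists2 K : R, 0 < K & forall (C : R) (eps : obs Omega -> R) x X, 0 < C ->
    sdp_optimal (fun a => That a + eps a) C x X ->
    frobenius (lifted_tensor T - bordered x X)
      <= K * chi (sup_norm eps + sup_norm eps ^+ 2 * C + C^-1).
Proof.
move=> T1 T0 SR; have Q0 := energy_ge0.
pose m : R := #|{: obs Omega}|%:R; have m0 : 0 <= m by [].
pose B := 2 * (energy + m) + 2.
have B0 : 0 <= B by rewrite /B; lra.
have [K1 K10 small] := trace_stability T1 T0 SR m0 B0.
pose K2 := (1 + energy) ^+ 2 + 1 + energy + m.
have K20 : 0 <= K2 by rewrite /K2; nra.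
pose N := ((1 + #|grid n|) * (1 + #|grid n|))%N.
exists (N%:R * (K1 + K2 + 1)).
  by rewrite mulr_gt0 ?ltr0n ?muln_gt0 //; lra.
move=> C eps x X C0 opt; set e := sup_norm eps.
have e0 : 0 <= e by apply: sup_norm_ge0.
have eC0 : 0 <= e ^+ 2 * C by rewrite mulr_ge0 ?sqr_ge0 ?ltW.
have V0 : 0 <= C^-1 by rewrite invr_ge0 ltW.
have trX := optimal_trace_bound (ltW C0) opt T1.
rewrite -/e -/m in trX.
have res a (aO : a \in Omega) := optimal_residual_bound C0 opt T1 aO.
rewrite -/e -/m in res.
set s := e + _ + _.
have s0 : 0 <= s by rewrite !addr_ge0.
have eCs : e ^+ 2 * C <= s by rewrite /s; lra.
have trs : \tr X <= energy + m * s by have := ler_wpM2l m0 eCs; lra.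
have sq0 := sqrtr_ge0 s.
have [fX _] := opt; have [_ _ pX] := fX.
rewrite -mulrA.
suff [hx hX] : (forall i, `|vec_tensor T i 0 - x i 0| <= (K1 + K2 + 1) * chi s) /\
    (forall i j, `|vec_tensor T i 0 * vec_tensor T j 0 - X i j|
        <= (K1 + K2 + 1) * chi s).
  apply: frobenius_bordered_bound => //.
    by rewrite mulr_ge0 /chi //; lra.
  by move=> i j; rewrite mxE big_ord1 [_^T _ _]mxE.
case: (lerP s 1) => s1.
  have [|hx hX] := small x X s fX s0 s1 trs.
    move=> a aO; apply: le_trans (res _ aO) _; rewrite /B.
    have Vs : C^-1 <= s by rewrite /s; lra.
    have es1 : e <= s by rewrite /s; lra.
    have es : e ^+ 2 <= s.
      apply: (le_trans _ es1); rewrite expr2 ler_piMr //.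
      exact: le_trans es1 s1.
    have := ler_wpM2l Q0 Vs; have := ler_wpM2l m0 es; lra.
  have le : K1 * Num.sqrt s <= (K1 + K2 + 1) * chi s.
    by apply: ler_pM => //; rewrite /chi; lra.
  by split=> [i|i j]; apply: le_trans le.
have [hx hX] := trace_crude_bound pX m0 (ltW s1) trs.
have le : K2 * s <= (K1 + K2 + 1) * chi s.
  by apply: ler_pM => //; rewrite /chi; lra.
by split=> [i|i j]; apply: le_trans le.
Qed.

End Stability.

Theorem theorem6 (R : realType) (d : nat) (n : 'I_d -> nat)
    (d_gt0 : (0 < d)%N) (n_gt0 : forall k : 'I_d, (0 < n k)%N)
    (Omega : {set grid n}) (That : obs Omega -> R)
    (That_neq0 : forall a : obs Omega, That a != 0)
    (T : {ffun grid n -> R})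
    (T_unique : unique (rank_one_completion That) T)
    (Omega_SR : SR_propagation Omega) :
  (exists K C0 eps0 : R,
    [/\ 0 < K, 0 < C0, 0 < eps0
      & forall (C : R) (eps : obs Omega -> R)
          (x : 'cV[R]_#|grid n|) (X : 'M[R]_#|grid n|),
        C0 <= C -> sup_norm eps <= eps0 ->
        sdp_optimal (fun a => That a + eps a) C x X ->
        frobenius (lifted_tensor T - bordered x X)
          <= K * chi (sup_norm eps + sup_norm eps ^+ 2 * C + C^-1)])
  /\
  (exists K eps0 : R,
    [/\ 0 < K, 0 < eps0
      & forall (eps : obs Omega -> R)
          (x : 'cV[R]_#|grid n|) (X : 'M[R]_#|grid n|),
        0 < sup_norm eps -> sup_norm eps <= eps0 ->
        sdp_optimal (fun a => That a + eps a) (sup_norm eps)^-1 x X ->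
        frobenius (lifted_tensor T - bordered x X)
          <= K * Num.sqrt (sup_norm eps)]).
Proof.
case: T_unique => -[T1 fit] _.
have T0 a : a \in Omega -> T a != 0.
  by move=> aO; have := That_neq0 (Sub a aO); rewrite -fit SubK.
have [K K0 bound] := recovery_error_bound fit T1 T0 Omega_SR.
split.
  exists K, 1, 1; split=> // C eps x X C1 _.
  exact: bound (lt_le_trans ltr01 C1).
(* For [C = 1 / e] the bound is [K * chi (3 e)], and 5 is [3 + 2], as
   [e <= sqrt e] and [sqrt 3 <= 2]. *)
exists (K * 5), 1; split=> [||eps x X e0 e1 opt]; rewrite ?mulr_gt0 //.
have V0 : 0 < (sup_norm eps)^-1 by rewrite invr_gt0.
apply: le_trans (bound _ _ _ _ V0 opt) _.
set e := sup_norm eps in e0 e1 *.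
have -> : e + e ^+ 2 * e^-1 + e^-1^-1 = 3 * e.
  by rewrite invrK expr2 mulfK ?gt_eqF //; ring.
rewrite -mulrA ler_pM2l // /chi sqrtrM //.
have q0 := sqrtr_ge0 e; have qe : Num.sqrt e ^+ 2 = e by rewrite sqr_sqrtr // ltW.
have t0 := sqrtr_ge0 (3 : R).
have t3 : Num.sqrt (3 : R) ^+ 2 = 3 by rewrite sqr_sqrtr.
have t2 : Num.sqrt (3 : R) <= 2 by nra.
have eq : e <= Num.sqrt e by nra.
have := ler_wpM2r q0 t2; lra.
Qed.
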